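(* Let $\mathbb{T}$ be a time scale, let $f,g:\mathbb{T}\to\mathbb{R}$ be two functions that are symmetric differentiable at $t\in\mathbb{T}_{\kappa}^{\kappa}$, and let $\lambda\in\mathbb{R}$. The following hold: (i) The function $f+g$ is symmetric differentiable at $t$ with $(f+g)^{\diamondsuit}(t)=f^{\diamondsuit}(t)+g^{\diamondsuit}(t)$. (ii) The function $\lambda f$ is symmetric differentiable at $t$ with $(\lambda f)^{\diamondsuit}(t)=\lambda f^{\diamondsuit}(t)$. (iii) If $f$ and $g$ are continuous at $t$, then $fg$ is symmetric differentiable at $t$ with $$(fg)^{\diamondsuit}(t)=f^{\diamondsuit}(t)\,g^{\sigma}(t)+f^{\rho}(t)\,g^{\diamondsuit}(t).$$ (iv) If $f$ is continuous at $t$ and $f^{\sigma}(t)f^{\rho}(t)\neq 0$, then $1/f$ is symmetric differentiable at $t$ with $$\left(\frac{1}{f}\right)^{\diamondsuit}(t)=-\frac{f^{\diamondsuit}(t)}{f^{\sigma}(t)f^{\rho}(t)}.$$ (v) If $f$ and $g$ are continuous at $t$ and $g^{\sigma}(t)g^{\rho}(t)\neq 0$, then $f/g$ is symmetric differentiable at $t$ with $$\left(\frac{f}{g}\right)^{\diamondsuit}(t)=\frac{f^{\diamondsuit}(t)\,g^{\rho}(t)-f^{\rho}(t)\,g^{\diamondsuit}(t)}{g^{\sigma}(t)g^{\rho}(t)}.$$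
   Context: A time scale $\mathbb{T}$ is a nonempty closed subset of $\mathbb{R}$, with the topology inherited from the standard topology of $\mathbb{R}$. The forward jump operator $\sigma:\mathbb{T}\to\mathbb{T}$ is $\sigma(t):=\inf\{s\in\mathbb{T}:s>t\}$ with the convention $\inf\emptyset=\sup\mathbb{T}$ (so $\sigma(M)=M$ if $\mathbb{T}$ has a maximum $M$); the backward jump operator $\rho:\mathbb{T}\to\mathbb{T}$ is $\rho(t):=\sup\{s\in\mathbb{T}:s<t\}$ with $\sup\emptyset=\inf\mathbb{T}$ (so $\rho(m)=m$ if $\mathbb{T}$ has a minimum $m$). A point $t\in\mathbb{T}$ is right-scattered if $\sigma(t)>t$ and left-scattered if $\rho(t)<t$. If $\sup\mathbb{T}$ is finite and left-scattered, $\mathbb{T}^{\kappa}:=\mathbb{T}\setminus\{\sup\mathbb{T}\}$, otherwise $\mathbb{T}^{\kappa}:=\mathbb{T}$; if $\inf\mathbb{T}$ is finite and right-scattered, $\mathbb{T}_{\kappa}:=\mathbb{T}\setminus\{\inf\mathbb{T}\}$, otherwise $\mathbb{T}_{\kappa}:=\mathbb{T}$; $\mathbb{T}_{\kappa}^{\kappa}:=\mathbb{T}_{\kappa}\cap\mathbb{T}^{\kappa}$. Write $f^{\sigma}:=f\circ\sigma$ and $f^{\rho}:=f\circ\rho$. Symmetric derivative: for $f:\mathbb{T}\to\mathbb{R}$ and $t\in\mathbb{T}_{\kappa}^{\kappa}$, the symmetric derivative of $f$ at $t$, denoted $f^{\diamondsuit}(t)$, is the real number (provided it exists) such that for every $\varepsilon>0$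 there is a neighborhood $U\subset\mathbb{T}$ of $t$ with $$\left|\left[f^{\sigma}(t)-f(s)+f(2t-s)-f^{\rho}(t)\right]-f^{\diamondsuit}(t)\left[\sigma(t)+2t-2s-\rho(t)\right]\right|\leqslant\varepsilon\left|\sigma(t)+2t-2s-\rho(t)\right|$$ for all $s\in U$ for which $2t-s\in U$. When such a number exists, $f$ is said to be symmetric differentiable at $t$. *)

(* Defs.v *)
From HB Require Import structures.
From mathcomp Require Import all_boot all_order all_algebra.
From mathcomp Require Import all_classical all_reals all_analysis.

Set Implicit Arguments.
Unset Strict Implicit.
Unset Printing Implicit Defensive.

Import Order.TTheory GRing.Theory Num.Theory.
Import numFieldNormedType.Exports.

Local Open Scope classical_set_scope.
Local Open Scope ring_scope.

(* A function on the time scale T is represented by a function R -> R: every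
   notion below only looks at its values on T. *)

Section TimeScale.
Context {R : realType}.
Implicit Types (T : set R) (f : R -> R) (t : R).

Definition time_scale T : Prop := T !=set0 /\ closed T.

(* The library's inf and sup send set0 to 0, whence the case distinction.
   For t in T, the first branch is only taken when t is the maximum
   (resp. minimum) of T, so that sup T (resp. inf T) is meaningful. *)
Definition forward_jump T t : R :=
  let above := [set s | T s /\ t < s] in
  if above == set0 then sup T else inf above.

Definition backward_jump T t : R :=
  let below := [set s | T s /\ s < t] in
  if below == set0 then inf T else sup below.

Definition right_scattered T t : Prop := t < forward_jump T t.

Definition left_scattered T t : Prop := backward_jump T t < t.

Definition upper_kappa T : set R :=
  if `[< has_ubound T /\ left_scattered T (sup T) >] then T `\ sup T else T.

Definition lower_kappa T : set R :=
  if `[< has_lbound T /\ right_scattered T (inf T) >] then T `\ inf T else T.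

Definition kappa T : set R := lower_kappa T `&` upper_kappa T.

(* subspace T carries the topology of R on T; for t in T, nbhs t in this space
   is within T (nbhs t). *)
Definition continuous_on_at T f t : Prop :=
  {for t, continuous (f : subspace T -> R)}.

(* "l is a symmetric derivative of f at t". This is a relation because l need
   not be unique: if sigma t = rho t = t and no s <> t near t has both s and
   2t - s in T, every l qualifies. *)
Definition is_sym_derive T f t (l : R) : Prop :=
  forall e : R, 0 < e ->
  exists U : set R,
    [/\ U `<=` T, nbhs (t : subspace T) U &
      forall s : R, U s -> U (2 * t - s) ->
        `| (f (forward_jump T t) - f s + f (2 * t - s) - f (backward_jump T t))
           - l * (forward_jump T t + 2 * t - 2 * s - backward_jump T t) |
        <= e * `| forward_jump T t + 2 * t - 2 * s - backward_jump T t | ].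

End TimeScale.

(* Main.v *)
Require Import Defs.
From HB Require Import structures.
From mathcomp Require Import all_boot all_order all_algebra.
From mathcomp Require Import all_classical all_reals all_analysis.
From mathcomp Require Import ring lra.

Set Implicit Arguments.
Unset Strict Implicit.
Unset Printing Implicit Defensive.

Import Order.TTheory GRing.Theory Num.Theory.
Import numFieldNormedType.Exports.

Local Open Scope classical_set_scope.
Local Open Scope ring_scope.

(** Every point [t] of [T] falls under one of two regimes.

    If [sigma t != rho t], then [T] has a gap on at least one side of [t], so
    that close to [t] the only [s] with both [s] and [2 t - s] in [T] is [t] itself.  The
    [epsilon]-condition then only speaks of [s = t], and [l] is a symmetric
    derivative of [f] at [t] iff [f (sigma t) - f (rho t)] is
    [l * (sigma t - rho t)] ([sym_derive_gapP]).  The calculus rules become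
    identities between fractions, and continuity plays no role.

    If [sigma t = rho t], both are equal to [t], and [l] is a symmetric
    derivative iff the quotient [(f (2 t - s) - f s) / (2 t - 2 s)] tends to [l]
    as [s <> t] tends to [t] with [s] and [2 t - s] in [T]
    ([sym_derive_denseP]).  This filter may contain the empty set, in which case
    every [l] qualifies; the limit theorems used hold for such filters too.
    The rules follow from the algebra of limits, since [f s] and [f (2 t - s)]
    both tend to [f t] when [f] is continuous at [t].

    The quotient rule is obtained as the product rule for [f] and [1 / g].  When
    [sigma t != rho t] the value [g t] may vanish, so that [1 / g] may fail to
    be continuous at [t]; for this reason the product and inverse rules are
    stated with continuity required only when [sigma t = rho t]. *)

Section SymmetricDerivative.
Context {R : realType}.
Implicit Types (T : set R) (f g : R -> R) (t l : R).

Lemma forward_jump_ge T t : T t -> t <= forward_jump T t.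
Proof.
move=> Tt; rewrite /forward_jump; case: ifPn => [/eqP above0|/set0P aboveN0].
  apply: ub_le_sup => //; exists t => s Ts; rewrite leNgt; apply/negP => ts.
  by have : [set s | T s /\ t < s] s by []; rewrite above0.
by apply: lb_le_inf => // s [_ /ltW].
Qed.

Lemma backward_jump_le T t : T t -> backward_jump T t <= t.
Proof.
move=> Tt; rewrite /backward_jump; case: ifPn => [/eqP below0|/set0P belowN0].
  apply: ge_inf => //; exists t => s Ts; rewrite leNgt; apply/negP => st.
  by have : [set s | T s /\ s < t] s by []; rewrite below0.
by apply: ge_sup => // s [_ /ltW].
Qed.

Lemma forward_jump_le T t s : T s -> t < s -> forward_jump T t <= s.
Proof.
move=> Ts ts; have sab : [set s | T s /\ t < s] s by [].
rewrite /forward_jump; case: ifPn => [/eqP above0|_].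
  by move: sab; rewrite above0.
by apply: ge_inf => //; exists t => x [_ /ltW].
Qed.

Lemma backward_jump_ge T t s : T s -> s < t -> s <= backward_jump T t.
Proof.
move=> Ts st; have sbe : [set s | T s /\ s < t] s by [].
rewrite /backward_jump; case: ifPn => [/eqP below0|_].
  by move: sbe; rewrite below0.
by apply: ub_le_sup => //; exists t => x [_ /ltW].
Qed.

Lemma jump_eq T t : T t -> forward_jump T t = backward_jump T t ->
  forward_jump T t = t /\ backward_jump T t = t.
Proof.
move=> Tt e; have := forward_jump_ge Tt; have := backward_jump_le Tt.
by rewrite e => h1 h2; split; apply/eqP; rewrite eq_le h1 h2.
Qed.

(** A gap of [T] on either side of [t] isolates [t] among the points whose
    reflection through [t] also lies in [T]. *)
Lemma near_gap_eq T t : T t -> forward_jump T t != backward_jump T t ->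
  \forall s \near t, T s -> T (2 * t - s) -> s = t.
Proof.
move=> Tt neq.
have tsig := forward_jump_ge Tt; have rhot := backward_jump_le Tt.
have d0 : 0 < forward_jump T t - backward_jump T t.
  by rewrite subr_gt0 lt_neqAle eq_sym neq (le_trans rhot).
have [tsig'|tsig'] := ltP t (forward_jump T t).
  near=> s => Ts Ts'.
  have : `|t - s| < forward_jump T t - t.
    by near: s; apply: cvgr_dist_lt; rewrite ?subr_gt0.
  rewrite ltr_norml => /andP[h1 h2].
  have [st|st|//] := ltgtP s t.
    have : t < 2 * t - s by lra.
    by move=> /(forward_jump_le Ts') h; lra.
  by have := forward_jump_le Ts st; lra.
near=> s => Ts Ts'.
have : `|t - s| < t - backward_jump T t.
  by near: s; apply: cvgr_dist_lt => //; lra.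
rewrite ltr_norml => /andP[h1 h2].
have [st|st|//] := ltgtP s t; first by have := backward_jump_ge Ts st; lra.
have : 2 * t - s < t by lra.
by move=> /(backward_jump_ge Ts') h; lra.
Unshelve. all: by end_near. Qed.

Lemma nbhs_subspaceE T t : T t -> nbhs (t : subspace T) = within T (nbhs t).
Proof. by move=> Tt; rewrite (nbhs_subspace_in Tt). Qed.

Lemma sym_derive_gapP T f t l : T t ->
  forward_jump T t != backward_jump T t ->
  is_sym_derive T f t l <->
  f (forward_jump T t) - f (backward_jump T t) =
    l * (forward_jump T t - backward_jump T t).
Proof.
move=> Tt neq; split=> [df|fE e e0].
  apply/eqP; rewrite -subr_eq0; set X := (X in X == 0).
  have d0 : 0 < `|forward_jump T t - backward_jump T t|.
    by rewrite normr_gt0 subr_eq0.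
  rewrite -normr_le0 leNgt; apply/negP => X0.
  (* With this epsilon, the condition at s = t reads |X| <= |X| / 2. *)
  have e0 : 0 < `|X| / `|forward_jump T t - backward_jump T t| / 2.
    by rewrite !divr_gt0.
  have [U [_ nU /(_ t)]] := df _ e0.
  have Ut : U t by exact: nbhs_subspace_singleton nU.
  have -> : 2 * t - t = t by ring.
  move=> /(_ Ut Ut).
  have -> : forward_jump T t + 2 * t - 2 * t - backward_jump T t =
    forward_jump T t - backward_jump T t by ring.
  rewrite subrK -/X => XX.
  suff : `|X| <= `|X| / 2 by lra.
  apply: (le_trans XX); rewrite mulrAC divfK //; exact: lt0r_neq0.
exists (T `&` [set s | T s -> T (2 * t - s) -> s = t]); split.
- by move=> s [].
- rewrite nbhs_subspaceE//; apply: filterS (near_gap_eq Tt neq).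
  by move=> s /= h Ts.
move=> s [Ts hs] [Ts' _]; have -> := hs Ts Ts'.
have -> : 2 * t - t = t by ring.
have -> : forward_jump T t + 2 * t - 2 * t - backward_jump T t =
    forward_jump T t - backward_jump T t by ring.
by rewrite subrK fE subrr normr0 mulr_ge0// ltW.
Qed.

(** The points [s <> t] close to [t] such that both [s] and its reflection
    [2 t - s] lie in [T].  This is a filter that need not be proper. *)
Definition sym_nbhs T t : set_system R :=
  within [set s | [/\ T s, T (2 * t - s) & s != t]] (nbhs t).

#[local] Instance sym_nbhs_filter T t : Filter (sym_nbhs T t).
Proof. exact: within_filter. Qed.

Lemma near_sym_nbhs T t :
  \forall s \near sym_nbhs T t, [/\ T s, T (2 * t - s) & s != t].
Proof. exact: withinT. Qed.

Lemma cvg_reflect t : 2 * t - s @[s --> t] --> t.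
Proof.
rewrite -[X in _ --> X](_ : 2 * t - t = t); last by ring.
by apply: cvgB; [exact: cvg_cst|exact: cvg_id].
Qed.

Lemma sym_derive_denseP T f t l : T t ->
  forward_jump T t = t -> backward_jump T t = t ->
  is_sym_derive T f t l <->
  (f (2 * t - s) - f s) / (2 * t - 2 * s) @[s --> sym_nbhs T t] --> l.
Proof.
move=> Tt sigE rhoE.
have diff0 s : s != t -> 2 * t - 2 * s != 0.
  by move=> /eqP st; apply/eqP => h; apply: st; lra.
have E s : s != t ->
    `|l - (f (2 * t - s) - f s) / (2 * t - 2 * s)| =
    `|(f t - f s + f (2 * t - s) - f t) - l * (t + 2 * t - 2 * s - t)|
      / `|t + 2 * t - 2 * s - t|.
  move=> /diff0 st; have -> : t + 2 * t - 2 * s - t = 2 * t - 2 * s by ring.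
  by rewrite -normf_div distrC; congr `|_|; field.
have E0 s : s != t -> 0 < `|t + 2 * t - 2 * s - t|.
  move=> /diff0; have -> : t + 2 * t - 2 * s - t = 2 * t - 2 * s by ring.
  by rewrite normr_gt0.
split=> [df|cf].
  apply/cvgrPdist_le => e e0.
  have [U []] := df _ e0; rewrite sigE rhoE => UT.
  rewrite nbhs_subspaceE// => nU dU.
  have nU' := cvg_reflect nU.
  rewrite near_withinE; near=> s => -[Ts Ts' st].
  rewrite E// ler_pdivrMr ?E0//; apply: dU.
    by move: Ts; near: s.
  by move: Ts'; near: s.
move=> e e0; move/cvgrPdist_le : cf => /(_ _ e0); rewrite near_withinE => cf.
exists (T `&` [set s | [/\ T s, T (2 * t - s) & s != t] ->
  `|l - (f (2 * t - s) - f s) / (2 * t - 2 * s)| <= e]); split.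
- by move=> s [].
- rewrite nbhs_subspaceE//; apply: filterS cf.
  by move=> s /= h Ts; split=> //; exact: h.
move=> s [Ts hs] [Ts' _]; rewrite sigE rhoE.
(* At s = t, a point excluded from the limit, both sides vanish. *)
have [->|st] := eqVneq s t.
  have -> : 2 * t - t = t by ring.
  have -> : t + 2 * t - 2 * t - t = 0 by ring.
  by rewrite subrK subrr mulr0 subrr normr0 mulr0.
by have := hs (And3 Ts Ts' st); rewrite /= E// ler_pdivrMr// E0.
Unshelve. all: by end_near. Qed.

Lemma cvg_sym_nbhs T f t : T t -> continuous_on_at T f t ->
  f s @[s --> sym_nbhs T t] --> f t.
Proof.
move=> Tt; rewrite /continuous_on_at /prop_for /continuous_at.
rewrite nbhs_subspaceE// => cf; apply: (cvg_trans _ cf); apply: cvg_fmap2.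
by apply: within_subset => s [].
Qed.

Lemma cvg_sym_nbhs_reflect T f t : T t -> continuous_on_at T f t ->
  f (2 * t - s) @[s --> sym_nbhs T t] --> f t.
Proof.
move=> Tt; rewrite /continuous_on_at /prop_for /continuous_at.
rewrite nbhs_subspaceE// => cf.
suff cr : 2 * t - s @[s --> sym_nbhs T t] --> within T (nbhs t).
  exact: cvg_comp cr cf.
move=> V nV.
have nV' : \forall s \near t, T (2 * t - s) -> V (2 * t - s).
  exact: (cvg_reflect (nV : nbhs t [set s | T s -> V s])).
change (\forall s \near t,
  [/\ T s, T (2 * t - s) & s != t] -> V (2 * t - s)).
by apply: filterS nV' => s /= h [_ Ts' _]; exact: h.
Qed.

Lemma sym_deriveD T f g t df dg : T t ->
  is_sym_derive T f t df -> is_sym_derive T g t dg ->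
  is_sym_derive T (fun s => f s + g s) t (df + dg).
Proof.
move=> Tt; have [e|ne] := eqVneq (forward_jump T t) (backward_jump T t).
  have [sigE rhoE] := jump_eq Tt e.
  rewrite !sym_derive_denseP// => cf cg.
  apply: (cvg_trans _ (cvgD cf cg)); apply: near_eq_cvg; near=> s.
  by rewrite !fctE; ring.
by rewrite !sym_derive_gapP// => hf hg; rewrite mulrDl -hf -hg; ring.
Unshelve. all: by end_near. Qed.

Lemma sym_deriveZ T f t a df : T t ->
  is_sym_derive T f t df -> is_sym_derive T (fun s => a * f s) t (a * df).
Proof.
move=> Tt; have [e|ne] := eqVneq (forward_jump T t) (backward_jump T t).
  have [sigE rhoE] := jump_eq Tt e.
  rewrite !sym_derive_denseP// => cf.
  apply: (cvg_trans _ (cvgM (cvg_cst a) cf)); apply: near_eq_cvg; near=> s.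
  by rewrite /=; ring.
by rewrite !sym_derive_gapP// => hf; rewrite -mulrA -hf; ring.
Unshelve. all: by end_near. Qed.

(** When [sigma t] and [rho t] coincide with [t], this is the limit of
    [(f s' - f s) * g s' + f s * (g s' - g s)] over [2 t - 2 s], where
    [s' = 2 t - s]. *)
Lemma sym_deriveM T f g t df dg : T t ->
  (forward_jump T t = backward_jump T t ->
    continuous_on_at T f t /\ continuous_on_at T g t) ->
  is_sym_derive T f t df -> is_sym_derive T g t dg ->
  is_sym_derive T (fun s => f s * g s) t
    (df * g (forward_jump T t) + f (backward_jump T t) * dg).
Proof.
move=> Tt; have [e|ne] := eqVneq (forward_jump T t) (backward_jump T t).
  have [sigE rhoE] := jump_eq Tt e.
  move=> /(_ e)[ctf ctg]; rewrite !sym_derive_denseP// => cf cg.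
  rewrite sigE rhoE.
  have cr := cvg_sym_nbhs_reflect Tt ctg; have cs := cvg_sym_nbhs Tt ctf.
  apply: (cvg_trans _ (cvgD (cvgM cf cr) (cvgM cs cg))).
  by apply: near_eq_cvg; near=> s; rewrite !fctE /=; ring.
move=> _; rewrite !sym_derive_gapP// => hf hg.
by rewrite mulrDl mulrAC -hf -mulrA -hg; ring.
Unshelve. all: by end_near. Qed.

Lemma sym_deriveV T f t df : T t ->
  (forward_jump T t = backward_jump T t -> continuous_on_at T f t) ->
  f (forward_jump T t) * f (backward_jump T t) != 0 ->
  is_sym_derive T f t df ->
  is_sym_derive T (fun s => (f s)^-1) t
    (- (df / (f (forward_jump T t) * f (backward_jump T t)))).
Proof.
move=> Tt; have [e|ne] := eqVneq (forward_jump T t) (backward_jump T t).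
  have [sigE rhoE] := jump_eq Tt e.
  move=> /(_ e) ctf; rewrite sigE rhoE => ff0.
  have ft0 : f t != 0 by move: ff0; rewrite mulf_eq0 orbb.
  rewrite !sym_derive_denseP// => cf.
  have cr := cvg_sym_nbhs_reflect Tt ctf; have cs := cvg_sym_nbhs Tt ctf.
  apply: (cvg_trans _ (cvgN (cvgM cf (cvgV ff0 (cvgM cr cs))))).
  apply: near_eq_cvg; near=> s; rewrite !fctE /=.
  have fs0 : f s != 0 by near: s; exact: cvgr_neq0 cs ft0.
  have fs'0 : f (2 * t - s) != 0 by near: s; exact: cvgr_neq0 cr ft0.
  have [_ _ /eqP st] : [/\ T s, T (2 * t - s) & s != t].
    by near: s; exact: near_sym_nbhs.
  have d0 : 2 * t - 2 * s != 0 by apply/eqP => h; apply: st; lra.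
  field.
  by rewrite fs0 d0.
move=> _; rewrite mulf_eq0 => /norP[fs0 fr0].
rewrite !sym_derive_gapP// => hf.
by rewrite mulNr mulrAC -hf; field; rewrite fr0.
Unshelve. all: by end_near. Qed.

Lemma continuous_on_atV T f t : f t != 0 ->
  continuous_on_at T f t -> continuous_on_at T (fun s => (f s)^-1) t.
Proof. by move=> ft0 cf; apply: cvgV. Qed.

Lemma sym_derive_div T f g t df dg : T t ->
  continuous_on_at T f t -> continuous_on_at T g t ->
  g (forward_jump T t) * g (backward_jump T t) != 0 ->
  is_sym_derive T f t df -> is_sym_derive T g t dg ->
  is_sym_derive T (fun s => f s / g s) t
    ((df * g (backward_jump T t) - f (backward_jump T t) * dg)
      / (g (forward_jump T t) * g (backward_jump T t))).
Proof.
move=> Tt cf cg gg0 hf /(sym_deriveV Tt (fun=> cg) gg0) hV.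
have [gs0 gr0] : g (forward_jump T t) != 0 /\ g (backward_jump T t) != 0.
  by move: gg0; rewrite mulf_eq0 => /norP.
have -> : (df * g (backward_jump T t) - f (backward_jump T t) * dg)
      / (g (forward_jump T t) * g (backward_jump T t)) =
    df * (g (forward_jump T t))^-1 + f (backward_jump T t) *
      - (dg / (g (forward_jump T t) * g (backward_jump T t))).
  by field; rewrite gr0.
apply: sym_deriveM => // /(jump_eq Tt)[sigE _]; split=> //.
by apply: continuous_on_atV => //; rewrite -sigE.
Qed.

End SymmetricDerivative.

Theorem theorem3p11 (R : realType) (T : set R) (hT : time_scale T)
    (f g : R -> R) (t : R) (ht : kappa T t) (df dg lambda : R)
    (hf : is_sym_derive T f t df) (hg : is_sym_derive T g t dg) :
  let sigma := forward_jump T in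
  let rho := backward_jump T in
  [/\ is_sym_derive T (fun s => f s + g s) t (df + dg),
      is_sym_derive T (fun s => lambda * f s) t (lambda * df),
      continuous_on_at T f t -> continuous_on_at T g t ->
        is_sym_derive T (fun s => f s * g s) t
          (df * g (sigma t) + f (rho t) * dg),
      continuous_on_at T f t -> f (sigma t) * f (rho t) != 0 ->
        is_sym_derive T (fun s => (f s)^-1) t
          (- (df / (f (sigma t) * f (rho t)))) &
      continuous_on_at T f t -> continuous_on_at T g t ->
      g (sigma t) * g (rho t) != 0 ->
        is_sym_derive T (fun s => f s / g s) t
          ((df * g (rho t) - f (rho t) * dg) / (g (sigma t) * g (rho t)))].
Proof.
have Tt : T t.
  by case: ht => _; rewrite /upper_kappa; case: ifP => // _ [].
split.
- exact: sym_deriveD.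
- exact: sym_deriveZ.
- by move=> cf cg; apply: sym_deriveM.
- by move=> cf ff0; apply: sym_deriveV.
- by move=> cf cg gg0; apply: sym_derive_div.
Qed.
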